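(* Let $i\in\mathcal V^\partial_{\rm s}$, let $\mathsf U_i=(\varrho_i,\mathsf M_i,\mathsf E_i)^T\in\mathcal A$, and let $\mathsf U_i^{\rm P}=(\varrho_i,\ \mathsf M_i-(\mathsf M_i\cdot\boldsymbol n_i^{\rm s})\boldsymbol n_i^{\rm s},\ \mathsf E_i)^T$. (i) Then $\mathsf U_i^{\rm P}$ is also admissible: $\mathsf U_i^{\rm P}\in\mathcal A$. (ii) Assume also that the equation of state derives from an entropy $s$. Then $s(\mathsf U_i^{\rm P})\ge s(\mathsf U_i)$. (iii) For all $i\in\mathcal V_{\rm s}^\partial\setminus\mathcal V_{\rm nr}^\partial$, the mass flux and the total energy flux of the postprocessed state at $i$ are zero, i.e. $\rho(\mathbb f(\mathsf U_i^{\rm P})\boldsymbol n_i)=0$ and $E(\mathbb f(\mathsf U_i^{\rm P})\boldsymbol n_i)=0$.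
   Context: $D\subset\mathbb R^d$ is a bounded polyhedral domain with outward unit normal field $\boldsymbol n$ on $\partial D$. A state is $\boldsymbol u=(\rho,\boldsymbol m,E)^T\in\mathbb R\times\mathbb R^d\times\mathbb R=\mathbb R^{d+2}$. For any vector in $\mathbb R^{d+2}$, $\rho(\cdot)$ denotes its first component, $\boldsymbol m(\cdot)$ the vector of its components $2,\dots,d+1$, and $E(\cdot)$ its last component. $\boldsymbol v=\boldsymbol m/\rho$, $e(\boldsymbol u)=E/\rho-\frac12\|\boldsymbol v\|^2$ is the specific internal energy. $\mathcal A=\{\boldsymbol u\in\mathbb R^{d+2}:\rho>0,\ e(\boldsymbol u)>0\}$ is the set of admissible states. $p:\mathcal A\to\mathbb R$ is the pressure. The flux is $\mathbb f(\boldsymbol u)=(\boldsymbol m,\ \boldsymbol v\otimes\boldsymbol m+p(\boldsymbol u)\mathbb I_d,\ \boldsymbol v(E+p(\boldsymbol u)))^T\in\mathbb R^{(d+2)\times d}$, so that $\mathbb f(\boldsymbol u)\boldsymbol w=(\boldsymbol m\cdot\boldsymbol w,\ (\boldsymbol v\cdot\boldsymbol w)\boldsymbol m+p\boldsymbol w,\ (\boldsymbol v\cdot\boldsymbol w)(E+p))^T$ for $\boldsymbol w\in\mathbb R^d$. $\{\varphi_i\}_{i\in\mathcal V}$ are the nonnegative global shape functions of a continuous Lagrange finite element space on a mesh covering $D$ exactly, with $\sum_i\varphi_i=1$. $\mathcal V^\partial$ is the set of $i\in\mathcal V$ with $\varphi_i|_{\partial D}\not\equiv0$. The boundary is partitioned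 into a slip part $\partial D_{\rm s}$ and its complement, the non-reflecting part $\partial D_{\rm nr}=\partial D\setminus\partial D_{\rm s}$; $\mathcal V_{\rm s}^\partial$ (resp. $\mathcal V_{\rm nr}^\partial$) is the set of $i\in\mathcal V^\partial$ with $\varphi_i|_{\partial D_{\rm s}}\not\equiv0$ (resp. $\varphi_i|_{\partial D_{\rm nr}}\not\equiv0$). Normals: $\boldsymbol n_i=\int_{\partial D}\varphi_i\boldsymbol n\,ds/\|\int_{\partial D}\varphi_i\boldsymbol n\,ds\|$ and $\boldsymbol n_i^{\rm s}=\int_{\partial D_{\rm s}}\varphi_i\boldsymbol n\,ds/\|\int_{\partial D_{\rm s}}\varphi_i\boldsymbol n\,ds\|$ (the denominators being nonzero). ''The equation of state derives from an entropy $s$'' means that there is a differentiable function $\sigma(\rho,e)$ (the specific entropy as a function of density and specific internal energy) with $s(\boldsymbol u)=\sigma(\rho(\boldsymbol u),e(\boldsymbol u))$ and satisfying the physical requirement $\partial_e\sigma(\rho,e)>0$ (positive temperature). *)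

(* Defs.v *)
From HB Require Import structures.
From mathcomp Require Import all_boot all_order all_algebra.
From mathcomp Require Import all_classical all_reals all_analysis.

Set Implicit Arguments.
Unset Strict Implicit.
Unset Printing Implicit Defensive.

Import Order.TTheory GRing.Theory Num.Theory.
Import numFieldNormedType.Exports.

Local Open Scope classical_set_scope.
Local Open Scope ring_scope.

(* The norm that the library puts on matrices is the sup norm, hence these
   Euclidean versions (the topologies agree). *)
Definition dotv (R : realType) (d : nat) (x y : 'cV[R]_d) : R :=
  \sum_(k < d) x k 0 * y k 0.

Definition enorm (R : realType) (d : nat) (x : 'cV[R]_d) : R :=
  Num.sqrt (dotv x x).

Definition ediam (R : realType) (d : nat) (A : set 'cV[R]_d) : \bar R :=
  ereal_sup [set (enorm (z.1 - z.2))%:E | z in A `*` A].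

(* Volume of the unit ball of R^n, from omega_(n+2) = 2 pi / (n+2) omega_n. *)
Fixpoint unit_ball_volume (R : realType) (n : nat) : R :=
  match n with
  | 0 => 1
  | 1 => 2
  | (n'.+2) => 2 * pi / n%:R * unit_ball_volume R n'
  end.

(* omega_s (diam A / 2)^s, the normalisation that makes the measure coincide
   with the area on flat pieces; the empty set is singled out because its
   diameter is -oo and because of the exponent s = 0. *)
Definition hausdorff_gauge (R : realType) (d s : nat) (A : set 'cV[R]_d) :
    \bar R :=
  if asbool (A = set0) then 0%E
  else ((unit_ball_volume R s)%:E * (ediam A * (2^-1)%:E) ^+ s)%E.

Definition hausdorff_pre (R : realType) (d s : nat) (delta : R)
    (A : set 'cV[R]_d) : \bar R :=
  ereal_inf [set (\sum_(k <oo) hausdorff_gauge s (F k))%E | F in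
    [set F : (set 'cV[R]_d)^nat |
      A `<=` \bigcup_k F k /\ forall k, (ediam (F k) <= delta%:E)%E]].

Definition hausdorff (R : realType) (d s : nat) (A : set 'cV[R]_d) : \bar R :=
  ereal_sup [set hausdorff_pre s delta A | delta in [set delta : R | 0 < delta]].

Section hausdorff_outer_measure.
Context (R : realType) (d s : nat).
Implicit Types (A : set 'cV[R]_d) (delta : R).
Local Open Scope ereal_scope.

Lemma unit_ball_volume_ge0 n : (0 <= unit_ball_volume R n)%R.
Proof.
suff : (0 <= unit_ball_volume R n)%R /\ (0 <= unit_ball_volume R n.+1)%R.
  by case.
elim: n => [|n [IH1 IH2]]; split=> //.
by rewrite [unit_ball_volume R n.+2]/= !mulr_ge0 ?invr_ge0 ?pi_ge0.
Qed.

Lemma dotvv_ge0 (x : 'cV[R]_d) : (0 <= dotv x x)%R.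
Proof. by apply: sumr_ge0 => k _; rewrite -expr2 sqr_ge0. Qed.

Lemma ediam_ge0 A : A !=set0 -> 0 <= ediam A.
Proof.
case=> x Ax; apply: (@le_trans _ _ (enorm (x - x))%:E).
  by rewrite lee_fin sqrtr_ge0.
by apply: ereal_sup_ubound; exists (x, x).
Qed.

Lemma hausdorff_gauge_ge0 A : 0 <= hausdorff_gauge s A.
Proof.
rewrite /hausdorff_gauge; case: asboolP => // /eqP/set0P A0.
apply: mule_ge0; first by rewrite lee_fin unit_ball_volume_ge0.
by rewrite expe_ge0// mule_ge0 ?ediam_ge0// lee_fin invr_ge0.
Qed.

Lemma hausdorff_gauge0 : hausdorff_gauge s (set0 : set 'cV[R]_d) = 0.
Proof. by rewrite /hausdorff_gauge asboolT. Qed.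

Let T := g_sigma_algebraType [set: set 'cV[R]_d].

Let gauge delta (A : set T) : \bar R :=
  if (ediam (A : set 'cV[R]_d) <= delta%:E)%E
  then hausdorff_gauge s (A : set 'cV[R]_d) else +oo.

Let gauge_ge0 delta A : 0 <= gauge delta A.
Proof. by rewrite /gauge; case: ifP => // _; exact: hausdorff_gauge_ge0. Qed.

Let gauge0 delta : gauge delta set0 = 0.
Proof.
rewrite /gauge hausdorff_gauge0 ifT// /ediam setX0 image_set0 ereal_sup0.
exact: leNye.
Qed.

Let hausdorff_preE delta :
  @hausdorff_pre R d s delta = @mu_ext _ T R (gauge delta).
Proof.
apply/funext => A; apply/eqP; rewrite eq_le; apply/andP; split.
- apply: le_ereal_inf_tmp => _ [F [_ AF] <-].
  have [dF|] := pselect (forall k, ediam (F k : set 'cV[R]_d) <= delta%:E).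
    apply: ereal_inf_lbound; exists F => //.
    by apply: eq_eseriesr => k _; rewrite /gauge dF.
  move=> /existsNP[k /negP dF].
  rewrite (@eseries_pinfty _ _ _ k) ?leey//.
    by move=> n _; rewrite -ltNye (lt_le_trans _ (gauge_ge0 _ _)).
  by rewrite /gauge (negbTE dF).
- apply: le_ereal_inf_tmp => _ [F [AF dF] <-].
  apply: ereal_inf_lbound; exists F.
    by split=> // k; exact: sub_sigma_algebra.
  by apply: eq_eseriesr => k _; rewrite /gauge dF.
Qed.

Let hausdorff_pre_ge0 delta A : 0 <= hausdorff_pre s delta A.
Proof. by rewrite hausdorff_preE; apply: mu_ext_ge0 => X; exact: gauge_ge0. Qed.

Let hausdorff_pre_le delta A : (0 < delta)%R ->
  hausdorff_pre s delta A <= hausdorff s A.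
Proof. by move=> d0; apply: ereal_sup_ubound; exists delta. Qed.

Lemma hausdorff_ge0 A : 0 <= hausdorff s A.
Proof. exact: le_trans (hausdorff_pre_ge0 _ _) (hausdorff_pre_le A ltr01). Qed.

Lemma hausdorff0 : hausdorff s (set0 : set 'cV[R]_d) = 0.
Proof.
apply/eqP; rewrite eq_le hausdorff_ge0 andbT.
by apply: ge_ereal_sup => _ [delta _ <-]; rewrite hausdorff_preE mu_ext0.
Qed.

Lemma le_hausdorff : {homo @hausdorff R d s : A B / A `<=` B >-> A <= B}.
Proof.
move=> A B AB; apply: ge_ereal_sup => _ [delta d0 <-].
apply: le_trans (hausdorff_pre_le B d0).
by rewrite hausdorff_preE; exact: le_mu_ext.
Qed.

Lemma hausdorff_sigma_subadditive : sigma_subadditive (@hausdorff R d s).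
Proof.
move=> F; apply: ge_ereal_sup => _ [delta d0 <-].
apply: (@le_trans _ _ (\sum_(i <oo) hausdorff_pre s delta (F i))).
  by rewrite hausdorff_preE; exact: mu_ext_sigma_subadditive.
by apply: lee_nneseries => i _ //; exact: hausdorff_pre_le.
Qed.

HB.instance Definition _ := isOuterMeasure.Build R 'cV[R]_d
  (@hausdorff R d s) hausdorff0 hausdorff_ge0 le_hausdorff
  hausdorff_sigma_subadditive.

End hausdorff_outer_measure.

Definition surface_outer (R : realType) (d : nat) :
    {outer_measure set 'cV[R]_d -> \bar R} := @hausdorff R d d.-1.

(* R^d with the sigma-algebra of the sets that are Caratheodory-measurable for
   the (d-1)-dimensional Hausdorff outer measure. *)
Notation surface_space R d := (caratheodory_type (surface_outer R d)).

Definition surface_measure (R : realType) (d : nat) :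
    {measure set (surface_space R d) -> \bar R} :=
  surface_outer R d : set (surface_space R d) -> \bar R.

Definition boundary (R : realType) (d : nat) (D : set 'cV[R]_d) :=
  closure D `\` interior D.

Definition polytope (R : realType) (d : nat) (K : set 'cV[R]_d) :=
  exists (n : nat) (a : 'I_n -> 'cV[R]_d),
    K = [set x | exists t : 'I_n -> R,
      [/\ forall k, 0 <= t k, \sum_(k < n) t k = 1 &
        x = \sum_(k < n) t k *: a k]].

(* D = interior (closure D) rules out cracks, along which D would lie on both
   sides of its boundary and have no outward normal. *)
Definition polyhedral_domain (R : realType) (d : nat) (D : set 'cV[R]_d) :=
  [/\ D !=set0, open D /\ connected D, bounded_set D,
      D = interior (closure D) &
      exists (n : nat) (K : 'I_n -> set 'cV[R]_d),
        (forall k, polytope (K k)) /\ closure D = \bigcup_k K k].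

Definition is_outward_normal (R : realType) (d : nat) (D : set 'cV[R]_d)
    (x nu : 'cV[R]_d) :=
  enorm nu = 1 /\ \forall y \near x, D y <-> dotv nu (y - x) < 0.

(* On the boundary of a polyhedral domain the normal exists in the relative
   interior of the faces; the value 0 is used at the remaining points (edges,
   corners), which are negligible for the surface measure. *)
Definition outward_normal (R : realType) (d : nat) (D : set 'cV[R]_d)
    (x : 'cV[R]_d) : 'cV[R]_d :=
  xget 0 [set nu | is_outward_normal D x nu].

Inductive poly_fun (R : realType) (d : nat) : ('cV[R]_d -> R) -> Prop :=
| PolyConst c : poly_fun (fun=> c)
| PolyCoord k : poly_fun (fun x => x k 0)
| PolyAdd f g : poly_fun f -> poly_fun g -> poly_fun (fun x => f x + g x)
| PolyMul f g : poly_fun f -> poly_fun g -> poly_fun (fun x => f x * g x).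

Record lagrange_element (R : realType) (d : nat) := LagrangeElement {
  ref_cell : set 'cV[R]_d;
  ref_space : set ('cV[R]_d -> R);
  ref_size : nat;
  ref_node : 'I_ref_size -> 'cV[R]_d;
  ref_cell_polytope : polytope ref_cell;
  ref_cell_solid : interior ref_cell !=set0;
  ref_space_poly : forall q, ref_space q -> poly_fun q;
  ref_space_lin : forall (a : R) q r, ref_space q -> ref_space r ->
    ref_space (fun x => a * q x + r x);
  ref_node_in : forall k, ref_cell (ref_node k);
  ref_unisolvent : forall c : 'I_ref_size -> R,
    exists! q, ref_space q /\ forall k, q (ref_node k) = c k }.

(* The reference element may vary from cell to cell (hybrid meshes), and the
   geometric maps are homeomorphisms onto the cells. *)
Record mesh (R : realType) (d : nat) (D : set 'cV[R]_d) := Mesh {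
  ncells : nat;
  elt : 'I_ncells -> lagrange_element R d;
  geo : 'I_ncells -> 'cV[R]_d -> 'cV[R]_d;
  cell := fun j => geo j @` ref_cell (elt j);
  geo_cont : forall j, {within ref_cell (elt j), continuous (geo j)};
  geo_inj : forall j, set_inj (ref_cell (elt j)) (geo j);
  cells_disj : forall j l, j != l ->
    interior (cell j) `&` interior (cell l) = set0;
  cells_cover : \bigcup_j cell j = closure D }.

Definition fe_space (R : realType) (d : nat) (D : set 'cV[R]_d) (M : mesh D) :
    set ('cV[R]_d -> R) :=
  [set v | {within closure D, continuous v} /\
    forall j : 'I_(ncells M), exists2 q, ref_space (elt j) q &
      forall x, ref_cell (elt j) x -> v (geo j x) = q x].

Definition lagrange_nodes (R : realType) (d : nat) (D : set 'cV[R]_d)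
    (M : mesh D) : set 'cV[R]_d :=
  [set a | exists (j : 'I_(ncells M)) (k : 'I_(ref_size (elt j))),
    a = geo j (ref_node k)].

(* The injection node identifies V with the set of Lagrange nodes; phi is then
   the nodal basis. *)
Definition lagrange_basis (R : realType) (d : nat) (D : set 'cV[R]_d)
    (M : mesh D) (V : finType) (phi : V -> 'cV[R]_d -> R) :=
  exists node : V -> 'cV[R]_d,
    [/\ injective node, range node = lagrange_nodes M,
        forall i, fe_space M (phi i) &
        forall i l, phi i (node l) = (i == l)%:R].

Definition bdry_dofs (R : realType) (d : nat) (D : set 'cV[R]_d) (V : finType)
    (phi : V -> 'cV[R]_d -> R) : set V :=
  [set i | exists2 x, boundary D x & phi i x <> 0].

Definition bdry_dofs_on (R : realType) (d : nat) (D : set 'cV[R]_d)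
    (V : finType) (phi : V -> 'cV[R]_d -> R) (G : set 'cV[R]_d) : set V :=
  [set i | bdry_dofs D phi i /\ exists2 x, G x & phi i x <> 0].

Definition normal_integral (R : realType) (d : nat) (D G : set 'cV[R]_d)
    (f : 'cV[R]_d -> R) : 'cV[R]_d :=
  \col_k \int[surface_measure R d]_(x in G) (f x * outward_normal D x k 0).

Definition mean_normal (R : realType) (d : nat) (D G : set 'cV[R]_d)
    (f : 'cV[R]_d -> R) : 'cV[R]_d :=
  (enorm (normal_integral D G f))^-1 *: normal_integral D G f.

Notation state R d := 'cV[R]_(1 + (d + 1)).

Definition mk_state (R : realType) (d : nat) (r : R) (m : 'cV[R]_d) (E : R) :
    state R d :=
  col_mx r%:M (col_mx m E%:M).

Definition rho (R : realType) (d : nat) (u : state R d) : R := usubmx u 0 0.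
Definition mom (R : realType) (d : nat) (u : state R d) : 'cV[R]_d :=
  usubmx (dsubmx u).
Definition ener (R : realType) (d : nat) (u : state R d) : R :=
  dsubmx (dsubmx u) 0 0.

Definition velocity (R : realType) (d : nat) (u : state R d) : 'cV[R]_d :=
  (rho u)^-1 *: mom u.

Definition internal_energy (R : realType) (d : nat) (u : state R d) : R :=
  ener u / rho u - 2^-1 * enorm (velocity u) ^+ 2.

Definition admissible (R : realType) (d : nat) : set (state R d) :=
  [set u | 0 < rho u /\ 0 < internal_energy u].

Definition flux (R : realType) (d : nat) (p : state R d -> R) (u : state R d) :
    'M[R]_(1 + (d + 1), d) :=
  col_mx (mom u)^T
    (col_mx (velocity u *m (mom u)^T + (p u)%:M)
            ((ener u + p u) *: (velocity u)^T)).

Definition derives_from_entropy (R : realType) (d : nat)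
    (s : state R d -> R) :=
  exists sigma : R -> R -> R,
    (forall r e : R, 0 < r -> 0 < e ->
       differentiable (fun z : R * R => sigma z.1 z.2) (r, e) /\
       0 < derive1 (sigma r) e) /\
    (forall u, admissible u -> s u = sigma (rho u) (internal_energy u)).

Definition postprocess (R : realType) (d : nat) (nu : 'cV[R]_d)
    (u : state R d) : state R d :=
  mk_state (rho u) (mom u - dotv (mom u) nu *: nu) (ener u).

(* Main.v *)
(* Removing the component of the momentum along the unit vector ns leaves the
   density and the total energy unchanged and lowers the kinetic energy, hence
   raises the internal energy, and the entropy is increasing in the latter at
   fixed density. Where phi_i vanishes on the non-reflecting part, the normals
   n_i and ns_i coincide, so the postprocessed velocity is orthogonal to n_i;
   both fluxes are multiples of that normal velocity. *)
Require Import Defs.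
From HB Require Import structures.
From mathcomp Require Import all_boot all_order all_algebra.
From mathcomp Require Import all_classical all_reals all_analysis.

Import Order.TTheory GRing.Theory Num.Theory.
Import numFieldNormedType.Exports.

Local Open Scope classical_set_scope.
Local Open Scope ring_scope.

Section dot_product.
Context {R : realType} {d : nat}.
Implicit Types x y z : 'cV[R]_d.

Lemma dotvDl x y z : dotv (x + y) z = dotv x z + dotv y z.
Proof.
by rewrite /dotv -big_split; apply: eq_bigr => k _; rewrite mxE mulrDl.
Qed.

Lemma dotvZl a x y : dotv (a *: x) y = a * dotv x y.
Proof.
by rewrite /dotv mulr_sumr; apply: eq_bigr => k _; rewrite mxE mulrA.
Qed.

Lemma dotvBl x y z : dotv (x - y) z = dotv x z - dotv y z.
Proof. by rewrite dotvDl -scaleN1r dotvZl mulN1r. Qed.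

Lemma dotvC x y : dotv x y = dotv y x.
Proof. by apply: eq_bigr => k _; rewrite mulrC. Qed.

Lemma sqr_enorm x : enorm x ^+ 2 = dotv x x.
Proof. by rewrite sqr_sqrtr// dotvv_ge0. Qed.

(** The nonzero denominators in the definition of the normals enter here: they make a mean normal a
    genuine unit vector. *)
Lemma dotv_normalized x : enorm x <> 0 ->
  dotv ((enorm x)^-1 *: x) ((enorm x)^-1 *: x) = 1.
Proof.
move=> /eqP x0; rewrite dotvZl dotvC dotvZl -sqr_enorm mulrA -expr2.
by rewrite -exprMn mulVf// expr1n.
Qed.

Lemma trmx_mul_dotv x y : (x^T *m y) 0 0 = dotv x y.
Proof. by rewrite mxE; apply: eq_bigr => k _; rewrite mxE. Qed.

Lemma dotv_proj x nu : dotv nu nu = 1 -> dotv (x - dotv x nu *: nu) nu = 0.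
Proof. by move=> nu1; rewrite dotvBl dotvZl nu1 mulr1 subrr. Qed.

(** Pythagoras: the projection is orthogonal to [nu], so the two sides differ by the square of
    [dotv x nu]. *)
Lemma le_dotv_proj x nu : dotv nu nu = 1 ->
  dotv (x - dotv x nu *: nu) (x - dotv x nu *: nu) <= dotv x x.
Proof.
move=> nu1; rewrite dotvBl dotvZl (dotvC nu) dotv_proj// mulr0 subr0.
by rewrite dotvC dotvBl dotvZl (dotvC nu) lerBlDr lerDl -expr2 sqr_ge0.
Qed.

End dot_product.

Section postprocess.
Context {R : realType} {d : nat}.
Implicit Types (U : state R d) (nu : 'cV[R]_d).

Lemma rho_mk_state (r : R) (m : 'cV[R]_d) E : rho (mk_state r m E) = r.
Proof. by rewrite /rho col_mxKu mxE. Qed.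

Lemma mom_mk_state (r : R) (m : 'cV[R]_d) E : mom (mk_state r m E) = m.
Proof. by rewrite /mom col_mxKd col_mxKu. Qed.

Lemma ener_mk_state (r : R) (m : 'cV[R]_d) E : ener (mk_state r m E) = E.
Proof. by rewrite /ener !col_mxKd mxE. Qed.

Lemma le_internal_energy_postprocess nu U : dotv nu nu = 1 ->
  internal_energy U <= internal_energy (postprocess nu U).
Proof.
move=> nu1; rewrite /internal_energy /velocity.
rewrite rho_mk_state mom_mk_state ener_mk_state.
rewrite lerD2l lerN2 ler_wpM2l ?invr_ge0 ?ler0n//.
(* Pulling [(rho U)^-1] out of both kinetic terms leaves a common squared factor in front of the
   squared norms of the two momenta. *)
rewrite !sqr_enorm !dotvZl !(dotvC _ (_ *: _)) !dotvZl !mulrA -!expr2.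
by rewrite ler_wpM2l ?sqr_ge0 ?le_dotv_proj.
Qed.

Lemma admissible_postprocess nu U : dotv nu nu = 1 ->
  admissible U -> admissible (postprocess nu U).
Proof.
move=> nu1 [rU eU]; split; first by rewrite rho_mk_state.
exact: lt_le_trans (le_internal_energy_postprocess nu U nu1).
Qed.

Lemma rho_flux (p : state R d -> R) U (w : 'cV[R]_d) :
  rho (flux p U *m w) = dotv (mom U) w.
Proof. by rewrite /rho /flux mul_col_mx col_mxKu trmx_mul_dotv. Qed.

(** Written as a multiple of the mass flux, so that both fluxes vanish together. *)
Lemma ener_flux (p : state R d -> R) U (w : 'cV[R]_d) :
  ener (flux p U *m w) = (ener U + p U) * (rho U)^-1 * dotv (mom U) w.
Proof.
rewrite /ener /flux !mul_col_mx !col_mxKd -scalemxAl mxE trmx_mul_dotv.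
by rewrite /velocity dotvZl mulrA.
Qed.

End postprocess.

(** Chain rule along the line [x |-> (r, x)]; it supplies the one-variable regularity behind the
    monotonicity of the entropy in [e]. *)
Lemma derivable_partial2 {R : realType} (sigma : R -> R -> R) (r e : R) :
  differentiable (fun z : R * R => sigma z.1 z.2) (r, e) ->
  derivable (sigma r) e 1.
Proof.
move=> df; apply/derivable1_diffP.
exact: (differentiable_comp (f := fun x => (r, x))
  (g := fun z : R * R => sigma z.1 z.2)).
Qed.

(** At the common density, [s] is a function of the internal energy alone, and its derivative is
    positive by positivity of the temperature. *)
Lemma le_entropy {R : realType} {d : nat} (s : state R d -> R)
    (U W : state R d) :
  derives_from_entropy s -> admissible U -> rho W = rho U ->
  internal_energy U <= internal_energy W -> s U <= s W.
Proof.
move=> [sigma [dsigma sE]] admU rWU eUW.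
have [rU eU] := admU.
have admW : admissible W by split; rewrite ?rWU// (lt_le_trans eU).
have dsig x : 0 < x -> derivable (sigma (rho U)) x 1.
  by move=> x0; apply: derivable_partial2; have [] := dsigma _ _ rU x0.
(* The whole segment between the two internal energies stays in the range where [sigma] is
   controlled. *)
have gt0 x : internal_energy U <= x -> 0 < x := lt_le_trans eU.
rewrite !sE// rWU.
apply: (@ger0_derive1_le_cc _ _ (internal_energy U) (internal_energy W)).
- by move=> x /itvP xI; apply/dsig/gt0; rewrite xI.
- by move=> x /itvP xI; apply: ltW; apply: (dsigma _ _ rU _).2; rewrite gt0 ?xI.
- apply: derivable_within_continuous => x /itvP xI.
  by apply/dsig/gt0; rewrite xI.
- by rewrite bound_itvE.
- by rewrite bound_itvE.
- exact: eUW.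
Qed.

(** Extended by zero to the whole space, the two integrands agree at every point. *)
Lemma normal_integral_subset {R : realType} {d : nat} (D G H : set 'cV[R]_d)
    (f : 'cV[R]_d -> R) :
  G `<=` H -> (forall x, (H `\` G) x -> f x = 0) ->
  normal_integral D H f = normal_integral D G f.
Proof.
move=> GH f0; apply/matrixP => k j; rewrite !mxE.
rewrite Rintegral_mkcond [RHS]Rintegral_mkcond; congr Rintegral.
apply/funext => x; rewrite !patchE.
have [xG|xG] := boolP (x \in G).
  by rewrite (mem_set (GH _ (set_mem xG))).
case: ifPn => // xH; rewrite f0 ?mul0r//; split; first exact: set_mem.
by move/mem_set; exact/negP.
Qed.

Theorem lemma4p2 (R : realType) (d : nat) (d_gt0 : (0 < d)%N)
  (D : set 'cV[R]_d) (polyD : polyhedral_domain D)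
  (M : mesh D) (V : finType) (phi : V -> 'cV[R]_d -> R)
  (phi_basis : lagrange_basis M phi)
  (phi_ge0 : forall i x, closure D x -> 0 <= phi i x)
  (phi_sum1 : forall x, closure D x -> \sum_i phi i x = 1)
  (Ds Dnr : set 'cV[R]_d)
  (Ds_bdry : Ds `<=` boundary D)
  (Ds_meas : measurable (Ds : set (surface_space R d)))
  (Dnr_def : Dnr = boundary D `\` Ds)
  (p : state R d -> R)
  (i : V) (i_slip : bdry_dofs_on D phi Ds i)
  (n_i_def : enorm (normal_integral D (boundary D) (phi i)) <> 0)
  (ns_i_def : enorm (normal_integral D Ds (phi i)) <> 0)
  (U : state R d) (U_adm : admissible U) :
  let n_i := mean_normal D (boundary D) (phi i) in
  let ns_i := mean_normal D Ds (phi i) in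
  let UP := postprocess ns_i U in
  [/\ admissible UP,
      forall s : state R d -> R, derives_from_entropy s -> s U <= s UP &
      ~ bdry_dofs_on D phi Dnr i ->
        rho (flux p UP *m n_i) = 0 /\ ener (flux p UP *m n_i) = 0].
Proof.
move=> n_i ns_i UP.
have ns1 : dotv ns_i ns_i = 1 by exact: dotv_normalized.
have admUP : admissible UP by exact: admissible_postprocess.
split=> // [s sP|inr].
  apply: le_entropy => //; first by rewrite rho_mk_state.
  exact: le_internal_energy_postprocess.
have -> : n_i = ns_i.
  rewrite /n_i /ns_i /mean_normal (normal_integral_subset D Ds)// => x bx.
  (* A point outside [Ds] where [phi i] is nonzero would make [i] a non-reflecting degree of
     freedom. *)
  apply: contrapT => phix; apply: inr; split; first by case: i_slip.
  by exists x => //; rewrite Dnr_def.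
by rewrite rho_flux ener_flux mom_mk_state dotv_proj// mulr0.
Qed.
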